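(* Let $A$ be a finite-dimensional real alternative $*$-algebra with quadratic cone $Q_A$, and let $\Omega_G$ be an axially symmetric domain in $Q_A$. Then there exists a slice regular function $f$ on $\Omega_G$ with discrete set of zeroes $D=\{q\in\Omega_G: f(q)=0\}$ which cannot be extended (as a slice regular function) to any larger axially symmetric domain $\Omega_H$ with $\Omega_G\subsetneq\Omega_H\subset Q_A$.
   Context: A finite-dimensional alternative real $*$-algebra $A$ is a finite-dimensional unital real algebra ($\mathbb{R}=\mathbb{R}\cdot 1\subset A$) with $x(xy)=(xx)y$ and $x(yy)=(xy)y$ for all $x,y\in A$, equipped with a real-linear involution $x\mapsto x^c$ satisfying $(xy)^c=y^cx^c$ and fixing $\mathbb{R}$ pointwise. The pseudosphere is $\mathbb{S}_A=\{w\in A: w+w^c=0,\ ww^c=1\}$ (so $w^2=-1$ for $w\in\mathbb{S}_A$), assumed to be non-empty; the quadratic cone is $Q_A=\mathbb{R}\cup\{w\in A: w+w^c\in\mathbb{R},\ ww^c\in\mathbb{R},\ 4ww^c>(w+w^c)^2\}=\{x+yI:x,y\in\mathbb{R},I\in\mathbb{S}_A\}$, with the subspace topology from the finite-dimensional vector space $A$. A symmetric domain in $\mathbb{C}$ is a (non-empty) open subset $G$ with $z\in G\iff\bar z\in G$ whose quotient by the relation $z\sim w\iff(z=w\text{ or }z=\bar w)$ is connected. Its associated axially symmetric domain is $\Omega_G=\{x+yI: x+yi\in G,\ x,y\in\mathbb{R},\ I\in\mathbb{S}_A\}\subset Q_A$; an axially symmetric domain is a set of this form. Let $A_{\mathbb{C}}=A\otimes_{\mathbb{R}}\mathbb{C}$,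 whose elements are written $a+ib$ with $a,b\in A$ ($i$ central), with complex conjugation $\overline{a+ib}=a-ib$. A stem function is a holomorphic map $F:G\to A_{\mathbb{C}}$ with $F(\bar z)=\overline{F(z)}$. A slice regular function on $\Omega_G$ is a function $f:\Omega_G\to A$ induced by a stem function $F=F'+iF''$ ($F',F'':G\to A$) via $f(x+yI)=F'(x+yi)+I\,F''(x+yi)$ for $x+yi\in G$, $I\in\mathbb{S}_A$. Extending $f$ to $\Omega_H$ means finding a slice regular function on $\Omega_H$ whose restriction to $\Omega_G$ is $f$. A subset of $\Omega_G$ is discrete if it has no accumulation point in $\Omega_G$. *)

(* Defs.v *)
From HB Require Import structures.
From mathcomp Require Import all_boot all_order all_algebra.
From mathcomp Require Import complex.
From mathcomp Require Import generic_quotient.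
From mathcomp Require Import ring lra.
From mathcomp Require Import all_classical all_reals all_analysis.

Set Implicit Arguments.
Unset Strict Implicit.
Unset Printing Implicit Defensive.

Import Order.TTheory GRing.Theory Num.Theory.
Import numFieldNormedType.Exports.

Local Open Scope classical_set_scope.
Local Open Scope ring_scope.
Local Open Scope quotient_scope.

(* A finite-dimensional real vector space has exactly one Hausdorff vector space
   topology, and any norm induces it: the choice of the norm is immaterial. The
   product [amul] is neither commutative nor associative in general. *)
HB.mixin Record isAltStarAlgebra (R : realType) A
    & NormedModule R A & Vector R A := {
  amul : A -> A -> A ;
  aone : A ;
  aconj : A -> A ;
  amul_linearl : forall x, linear (fun y => amul y x) ;
  amul_linearr : forall x, linear (amul x) ;
  amul1x : forall x, amul aone x = x ;
  amulx1 : forall x, amul x aone = x ;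
  aone_neq0 : aone != 0 ;
  amul_altl : forall x y, amul x (amul x y) = amul (amul x x) y ;
  amul_altr : forall x y, amul x (amul y y) = amul (amul x y) y ;
  aconj_linear : linear aconj ;
  aconjK : forall x, aconj (aconj x) = x ;
  aconjM : forall x y, aconj (amul x y) = amul (aconj y) (aconj x) ;
  aconj_real : forall r : R, aconj (r *: aone) = r *: aone
}.

#[short(type="altStarAlgType")]
HB.structure Definition AltStarAlgebra (R : realType) :=
  {A of NormedModule R A & Vector R A & isAltStarAlgebra R A}.

Section QuadraticCone.
Context {R : realType} {A : altStarAlgType R}.

Definition areal (r : R) : A := r *: aone.

Definition pseudosphere : set A :=
  [set w | w + aconj w = 0 /\ amul w (aconj w) = aone].

Definition quadratic_cone : set A :=
  range areal `|`
  [set w | exists t n : R, [/\ w + aconj w = areal t,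
                               amul w (aconj w) = areal n &
                               t ^+ 2 < 4 * n]].

(* The point [x + y I], i.e. [areal x + amul (areal y) I]. *)
Definition slice_point (x y : R) (I : A) : A := areal x + y *: I.

Lemma aconjD (x y : A) : aconj (x + y) = aconj x + aconj y.
Proof. by rewrite -[x in LHS]scale1r aconj_linear scale1r. Qed.

Lemma aconj0 : aconj (0 : A) = 0.
Proof. by apply: (addrI (aconj 0)); rewrite -aconjD !addr0. Qed.

Lemma aconjZ (r : R) (x : A) : aconj (r *: x) = r *: aconj x.
Proof. by rewrite -[r *: x]addr0 aconj_linear aconj0 addr0. Qed.

Lemma amulDr (x y z : A) : amul x (y + z) = amul x y + amul x z.
Proof. by rewrite -[y]scale1r amul_linearr !scale1r. Qed.

Lemma amulDl (x y z : A) : amul (y + z) x = amul y x + amul z x.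
Proof. by have /= := amul_linearl x 1 y z; rewrite !scale1r. Qed.

Lemma amulr0 (x : A) : amul x 0 = 0.
Proof. by apply: (addrI (amul x 0)); rewrite -amulDr !addr0. Qed.

Lemma amul0r (x : A) : amul 0 x = 0.
Proof. by apply: (addrI (amul 0 x)); rewrite -amulDl !addr0. Qed.

Lemma amulZr (r : R) (x y : A) : amul x (r *: y) = r *: amul x y.
Proof. by rewrite -[r *: y]addr0 amul_linearr amulr0 addr0. Qed.

Lemma amulZl (r : R) (x y : A) : amul (r *: y) x = r *: amul y x.
Proof.
by have /= := amul_linearl x r y 0; rewrite !addr0 amul0r addr0.
Qed.

Lemma slice_pointE (x y : R) (I : A) :
  slice_point x y I = areal x + amul (areal y) I.
Proof. by rewrite /slice_point /areal amulZl amul1x. Qed.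

Lemma amulNr (x y : A) : amul x (- y) = - amul x y.
Proof. by rewrite -scaleN1r amulZr scaleN1r. Qed.

Lemma amulNl (x y : A) : amul (- y) x = - amul y x.
Proof. by rewrite -scaleN1r amulZl scaleN1r. Qed.

Lemma pseudosphereP (I : A) :
  pseudosphere I <-> aconj I = - I /\ amul I I = - aone.
Proof.
split=> [[I0 I1]|[cI II]].
  have cI : aconj I = - I by apply/eqP; rewrite -addr_eq0 addrC I0.
  by split=> //; move: I1; rewrite cI amulNr => <-; rewrite opprK.
by split; rewrite cI ?subrr// amulNr II opprK.
Qed.

Lemma amul_slice (x y u v : R) (I : A) : amul I I = - aone ->
  amul (slice_point x y I) (slice_point u v I) =
  slice_point (x * u - y * v) (x * v + y * u) I.
Proof.
move=> II; rewrite /slice_point /areal amulDl !amulDr !amulZl !amulZr.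
rewrite amul1x amulx1 amul1x II !scalerA scalerN scalerBl scalerDl.
by rewrite [RHS]addrAC !addrA.
Qed.

Lemma aconj_slice (x y : R) (I : A) : aconj I = - I ->
  aconj (slice_point x y I) = slice_point x (- y) I.
Proof.
by move=> cI; rewrite /slice_point aconjD aconj_real aconjZ cI scalerN scaleNr.
Qed.

Lemma quadratic_coneE : pseudosphere !=set0 ->
  quadratic_cone = [set w | exists x y : R, exists2 I : A,
                              pseudosphere I & w = slice_point x y I].
Proof.
move=> [J SJ]; apply/seteqP; split=> w /=.
  move=> [[r _ <-]|[t [n [wt wn tn]]]].
    by exists r, 0, J => //; rewrite /slice_point scale0r addr0.
  pose h : R := t / 2; have [v vE] : exists v, v = w - areal h by exists (w - areal h).
  pose d := n - h ^+ 2.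
  have d0 : 0 < d by rewrite /d /h; lra.
  have cw : aconj w = areal t - w by rewrite -wt addrC addKr.
  have cv : aconj v = - v.
    rewrite vE -scaleN1r aconjD aconjZ aconj_real scaleN1r cw opprB.
    have -> : areal t = areal h + areal h :> A.
      by rewrite /areal -scalerDl; congr (_ *: _); rewrite /h; lra.
    by rewrite addrAC addrK.
  have vv : amul v v = - areal d.
    have wE : w = areal h + v by rewrite vE addrC subrK.
    move: wn; rewrite wE aconjD aconj_real cv amulDl !amulDr !amulNr.
    rewrite /areal !amulZl !amulZr amulx1 !amul1x scalerA.
    rewrite amulx1 addrA subrK => E.
    by rewrite /d scalerBl opprB -E expr2 subKr.
  exists h, (Num.sqrt d), ((Num.sqrt d)^-1 *: v).
    apply/pseudosphereP; rewrite aconjZ cv scalerN; split=> //.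
    rewrite amulZl amulZr scalerA vv scalerN scalerA -invfM -expr2 sqr_sqrtr ?ltW//.
    by rewrite mulVf ?gt_eqF// scale1r.
  rewrite /slice_point scalerA divff ?gt_eqF ?sqrtr_gt0// scale1r.
  by rewrite vE addrC subrK.
move=> [x [y [I /pseudosphereP[cI II] ->]]].
have [->|y0] := eqVneq y 0.
  by left; exists x => //; rewrite /slice_point scale0r addr0.
right; exists (x + x), (x ^+ 2 + y ^+ 2); rewrite aconj_slice//; split.
- by rewrite /slice_point addrACA -!scalerDl subrr scale0r addr0.
- rewrite amul_slice// /slice_point (_ : _ + _ * x = 0) ?scale0r ?addr0; last by ring.
  by congr areal; ring.
- by have : 0 < y ^+ 2 by [rewrite exprn_even_gt0]; nra.
Qed.

End QuadraticCone.

Arguments pseudosphere {R} A.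
Arguments quadratic_cone {R} A.

(* [R[i]^o] is [R[i]] with its structure of normed space over itself. *)
Section SymmetricDomain.
Context {R : realType}.
Variable G : set R[i]^o.

Definition conj_rel : rel G :=
  fun z w => (val z == val w) || (val z == conjc (val w)).

Lemma conj_rel_refl : reflexive conj_rel.
Proof. by move=> z; rewrite /conj_rel eqxx. Qed.

Lemma conj_rel_sym : symmetric conj_rel.
Proof.
move=> z w; rewrite /conj_rel eq_sym; congr orb.
by apply/eqP/eqP => ->; rewrite conjcK.
Qed.

Lemma conj_rel_trans : transitive conj_rel.
Proof.
move=> w z u; rewrite /conj_rel => /orP[]/eqP-> /orP[]/eqP->.
- by rewrite eqxx.
- by rewrite eqxx orbT.
- by rewrite eqxx orbT.
- by rewrite conjcK eqxx.
Qed.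

Definition conj_equiv : equiv_rel G :=
  EquivRel conj_rel conj_rel_refl conj_rel_sym conj_rel_trans.

Definition conj_quotient := quotient_topology {eq_quot conj_equiv}.

Definition symmetric_domain : Prop :=
  [/\ G !=set0, open G, (forall z, G z <-> G (conjc z)) &
      connected [set: conj_quotient]].

End SymmetricDomain.

(* [(a, b)] stands for [a + i b]. *)
Definition complexification (R : realType) (A : altStarAlgType R) : Type :=
  (A * A)%type.

Section Complexification.
Context {R : realType} {A : altStarAlgType R}.
Local Notation AC := (complexification A).

HB.instance Definition _ := GRing.Zmodule.copy AC (A * A)%type.
HB.instance Definition _ := Topological.copy AC (A * A)%type.
HB.instance Definition _ := isPointed.Build AC 0.

Definition scaleAC (z : R[i]) (u : AC) : AC :=
  let: Complex a b := z in (a *: u.1 - b *: u.2, a *: u.2 + b *: u.1).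

Lemma scaleACA (z w : R[i]) (u : AC) : scaleAC z (scaleAC w u) = scaleAC (z * w) u.
Proof.
case: z w u => [a b] [c d] [u v]; rewrite /scaleAC /=; congr pair.
  rewrite !scalerBr !scalerDr !scalerBl !scalerDl !scalerA !opprD.
  by rewrite [RHS]addrAC !addrA.
rewrite !scalerBr !scalerDr !scalerBl !scalerDl !scalerA.
by rewrite [RHS]addrAC !addrA.
Qed.

Lemma scaleAC1 : left_id 1 scaleAC.
Proof.
by case=> u v; rewrite /scaleAC /= !scale1r !scale0r subr0 addr0.
Qed.

Lemma scaleACDr : right_distributive scaleAC +%R.
Proof.
move=> [a b] [u v] [u' v']; rewrite /scaleAC /=; congr pair => /=.
  by rewrite !scalerDr opprD addrACA.
by rewrite !scalerDr addrACA.
Qed.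

Lemma scaleACDl (u : AC) : {morph scaleAC^~ u : z w / z + w}.
Proof.
case: u => u v [a b] [c d]; rewrite /scaleAC /=; congr pair => /=.
  by rewrite !scalerDl opprD addrACA.
by rewrite !scalerDl addrACA.
Qed.

HB.instance Definition _ := GRing.Zmodule_isLmodule.Build R[i] AC
  scaleACA scaleAC1 scaleACDr scaleACDl.

Definition complexification_conj (u : AC) : AC := (u.1, - u.2).

Definition holomorphic_on (G : set R[i]^o) (F : R[i]^o -> AC) : Prop :=
  forall z, G z ->
    cvg ((fun h : R[i]^o => (h : R[i])^-1 *: (F (z + h) - F z)) @ 0^').

Definition stem_function (G : set R[i]^o) (F : R[i]^o -> AC) : Prop :=
  holomorphic_on G F /\
  forall z, G z -> F (conjc z) = complexification_conj (F z).

End Complexification.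

Section SliceRegular.
Context {R : realType} {A : altStarAlgType R}.
Implicit Types (G : set R[i]^o) (f : A -> A).

Definition axial_domain G : set A :=
  [set q | exists x y : R, exists I : A,
     [/\ G (Complex x y), pseudosphere A I & q = slice_point x y I]].

(* A function on [axial_domain G] is represented by a map on [A] whose values
   outside of [axial_domain G] are irrelevant. *)
Definition slice_regular G f : Prop :=
  exists2 F : R[i]^o -> complexification A, stem_function G F &
    forall (x y : R) (I : A), G (Complex x y) -> pseudosphere A I ->
      f (slice_point x y I) =
        (F (Complex x y)).1 + amul I (F (Complex x y)).2.

Definition zeroes G f : set A := [set q | axial_domain G q /\ f q = 0].

Definition discrete_in (X D : set A) : Prop :=
  D `<=` X /\ X `&` limit_point D = set0.

End SliceRegular.

Lemma axial_domain_sub_cone (R : realType) (A : altStarAlgType R)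
  (G : set R[i]^o) : axial_domain G `<=` quadratic_cone A.
Proof.
move=> q [x [y [I [_ SI ->]]]].
by rewrite quadratic_coneE; [exists x, y, I|exists I].
Qed.

Arguments axial_domain {R} A G.

(* Main.v *)
Require Import Defs.
From mathcomp Require Import all_boot all_order all_algebra.
From mathcomp Require Import complex.
From mathcomp Require Import generic_quotient.
From mathcomp Require Import ring lra.
From mathcomp Require Import all_classical all_reals all_analysis.
Import Order.TTheory GRing.Theory Num.Theory.
Import numFieldNormedType.Exports.
Local Open Scope classical_set_scope.
Local Open Scope ring_scope.

Set Implicit Arguments.
Unset Strict Implicit.
Unset Printing Implicit Defensive.

(** A complex-valued holomorphic function [phi] on [G] commuting with conjugation
    is a stem function with values in the span of [1], and the function [f] that it
    induces satisfies [f (x + y I) = Re (phi z) + Im (phi z) I] for [z = x + y i].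
    So the zeroes of [f] are the spheres over the zeroes of [phi]. Such spheres need
    not be discrete, but there are none when [phi = cexp \o h] is an exponential:
    the zero set is then empty, and it remains to find an [h] for which [f] does
    not extend.

    A slice regular extension to a larger domain over [H] has a stem function on [H]
    that agrees with that of [f] on [G] ([stem_unique]) and is bounded near every
    point of [H] ([holomorphic_locally_bounded]). As the quotient of [H] by
    conjugation is connected, some boundary point [b] of [G] lies in [H]
    ([exists_frontier_point]). It therefore suffices that [Re \o h] is unbounded
    above near every boundary point of [G] ([exists_barrier]): the modulus of [phi]
    is [expR (Re (h z))].

    The function [h] is a sum of simple poles with real residues,
    [\sum_m 64 ^- m * s_m * ((z - a_m)^-1 + (z - conjc a_m)^-1)]. For a dense
    sequence [p_m] in [G], the pole [a_m] is a point of the complement nearest to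
    [p_m], and the sign [s_m] is that of the real part of [p_m - a_m]. The poles are
    dense in the boundary, and each of them lies on the rim of a disc contained in
    [G]. Inside this disc one can approach [a_n] so that the distance to all the
    other poles is bounded below by a multiple of the distance to [a_n]; the
    geometric weights then let the [n]th term dominate the later ones, while the
    finitely many earlier terms stay bounded ([barrier_blow_up_first]). *)

(** * Sums with weights [64 ^- m] *)
Section WeightedSum.
Context {R : realType}.
Implicit Types (u v : R^nat) (M r : R).

Definition weighted u : R^nat := fun m => 64^-1 ^+ m * u m.

Definition wsum u : R := limn (series (weighted u)).

Lemma is_cvg_wsum M u : (forall m, `|u m| <= M) -> cvgn (series (weighted u)).
Proof.
move=> uM; apply: normed_cvg; apply: (@series_le_cvg _ _ (geometric M 64^-1)).
- by move=> n; exact: normr_ge0.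
- by move=> n; rewrite /geometric mulr_ge0 ?exprn_ge0// (le_trans _ (uM 0%N)).
- move=> n; rewrite /weighted /= normrM ger0_norm ?exprn_ge0// mulrC.
  by rewrite ler_wpM2r// exprn_ge0.
- by apply: is_cvg_geometric_series; rewrite ger0_norm//; lra.
Qed.

Lemma wsumD M N u v : (forall m, `|u m| <= M) -> (forall m, `|v m| <= N) ->
  wsum (fun m => u m + v m) = wsum u + wsum v.
Proof.
move=> /is_cvg_wsum uM /is_cvg_wsum vN.
rewrite /wsum -lim_seriesD//; congr (limn (series _)).
by apply/funext => m; rewrite /weighted /= mulrDr.
Qed.

Lemma wsumZ M r u : (forall m, `|u m| <= M) ->
  wsum (fun m => r * u m) = r * wsum u.
Proof.
move=> /is_cvg_wsum uM.
rewrite /wsum -[RHS]/(r *: limn _) -lim_seriesZ//; congr (limn (series _)).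
by apply/funext => m; rewrite /weighted /= mulrCA.
Qed.

(** Splitting off the first term turns statements about a later index into
    inductions on that index. *)
Lemma wsum_rec M u : (forall m, `|u m| <= M) ->
  wsum u = u 0%N + 64^-1 * wsum (fun m => u m.+1).
Proof.
move=> uM; have su : cvgn (series (weighted (fun m => u m.+1))).
  by apply: (@is_cvg_wsum M) => m.
rewrite /wsum -[_ * limn (series (weighted (fun m => u m.+1)))]/(64^-1 *: limn _).
rewrite -lim_seriesZ//; set v := _ *: _.
have cv : cvgn (series v) by exact: is_cvg_seriesZ.
have E : [sequence series (weighted u) n.+1]_n = (fun n => u 0%N + series v n).
  apply/funext => n /=; rewrite /series /= big_nat_recl// /weighted expr0 mul1r.
  by congr (_ + _); apply: eq_bigr => i _; rewrite /v /weighted /= exprS -mulrA.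
apply/cvg_lim => //; rewrite -(cvg_shiftS _).
by move: E; rewrite /= => ->; apply: cvgD; [exact: cvg_cst|exact: cv].
Qed.

Lemma wsum_norm_le M u : (forall m, `|u m| <= M) -> `|wsum u| <= 2 * M.
Proof.
move=> uM; have M0 : 0 <= M by exact: le_trans (uM 0%N).
have cg : series (geometric M 64^-1) @ \oo --> M * (1 - 64^-1)^-1.
  by apply: cvg_geometric_series; rewrite ger0_norm//; lra.
have b n : weighted u n <= geometric M 64^-1 n /\
           - geometric M 64^-1 n <= weighted u n.
  have : `|weighted u n| <= geometric M 64^-1 n.
    rewrite /weighted normrM ger0_norm ?exprn_ge0// mulrC.
    by rewrite ler_wpM2r// exprn_ge0.
  by rewrite ler_norml => /andP[].
have cu := is_cvg_wsum uM.
have l1 : wsum u <= limn (series (geometric M 64^-1)).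
  apply: lim_series_le => //; first by apply/cvg_ex; eexists; exact: cg.
  by move=> n; have [] := b n.
have l2 : - limn (series (geometric M 64^-1)) <= wsum u.
  rewrite -lim_seriesN; last by apply/cvg_ex; eexists; exact: cg.
  apply: lim_series_le => //; last by move=> n; have [] := b n.
  by rewrite is_cvg_seriesN; apply/cvg_ex; eexists; exact: cg.
have E : limn (series (geometric M 64^-1)) = M * (1 - 64^-1)^-1 by exact/cvg_lim.
have q : (1 - 64^-1)^-1 = 64 / 63 :> R by field.
rewrite E q in l1 l2; rewrite ler_norml; apply/andP; split; lra.
Qed.

(** One large term dominates all later ones of comparable size, since
    [\sum_(m > n) 64 ^- m <= 64 ^- n / 32]. The earlier terms carry larger
    weights, so for them an absolute bound [K] has to be supplied. *)
Lemma wsum_ge M n u K a b : (forall m, `|u m| <= M) -> 0 <= K ->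
  (forall m, (m < n)%N -> - K <= u m) -> a <= u n ->
  (forall m, (n < m)%N -> `|u m| <= b) ->
  64^-1 ^+ n * (a - b / 32) - 2 * K <= wsum u.
Proof.
elim: n u => [|n IH] u uM K0 uK ua ub; rewrite (wsum_rec uM).
  have : `|wsum (fun m => u m.+1)| <= 2 * b by apply: wsum_norm_le => m; exact: ub.
  by rewrite ler_norml expr0 => /andP[]; lra.
have := IH (fun m => u m.+1) (fun m => uM m.+1) K0 (fun m => uK m.+1) ua
  (fun m => ub m.+1).
have := uK 0%N isT; rewrite exprS -mulrA; set P := _ ^+ n * _; lra.
Qed.

End WeightedSum.

(** * The modulus and the exponential of a complex number *)
Section ComplexExponential.
Context {R : realType}.
Implicit Types (z w k : R[i]) (x y : R).
Local Notation Re := complex.Re.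
Local Notation Im := complex.Im.

Lemma sqr_le_of_norm x y : `|x| <= y -> x ^+ 2 <= y ^+ 2.
Proof.
move=> xy; rewrite -[x ^+ 2]real_normK ?num_real//.
by rewrite lerXn2r// nnegrE ?normr_ge0// (le_trans (normr_ge0 x)).
Qed.

Definition modulus z : R := Normc.normc z.

Lemma modulusE z : `|z| = (modulus z)%:C%C.
Proof. by case: z. Qed.

Lemma modulus_ge0 z : 0 <= modulus z.
Proof. by case: z => a b; exact: sqrtr_ge0. Qed.

Lemma modulus0 : modulus 0 = 0. Proof. exact: Normc.normc0. Qed.

Lemma modulusM z w : modulus (z * w) = modulus z * modulus w.
Proof. exact: Normc.normcM. Qed.

Lemma modulusV z : modulus z^-1 = (modulus z)^-1.
Proof. exact: Normc.normcV. Qed.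

Lemma modulusD z w : modulus (z + w) <= modulus z + modulus w.
Proof. exact: le_normcD. Qed.

Lemma modulusN z : modulus (- z) = modulus z.
Proof. exact: normcN. Qed.

Lemma modulusB z w : modulus (z - w) = modulus (w - z).
Proof. by rewrite -modulusN opprB. Qed.

Lemma modulus_eq0 z : modulus z = 0 -> z = 0.
Proof. exact: Normc.eq0_normc. Qed.

Lemma modulus_gt0 z : z != 0 -> 0 < modulus z.
Proof.
move=> z0; rewrite lt_def modulus_ge0 andbT.
by apply: contra z0 => /eqP/modulus_eq0 ->.
Qed.

Lemma modulusJ z : modulus (conjc z) = modulus z.
Proof. by case: z => a b /=; rewrite /modulus /= sqrrN. Qed.

Lemma modulus_sqr z : modulus z ^+ 2 = Re z ^+ 2 + Im z ^+ 2.
Proof. by case: z => a b; rewrite /modulus /= sqr_sqrtr// addr_ge0 ?sqr_ge0. Qed.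

Lemma normr_Re_le z : `|Re z| <= modulus z.
Proof.
rewrite -(ler_pXn2r (ltn0Sn 1)) ?nnegrE ?normr_ge0 ?modulus_ge0//.
by rewrite modulus_sqr real_normK ?num_real// lerDl sqr_ge0.
Qed.

Lemma normr_Im_le z : `|Im z| <= modulus z.
Proof.
rewrite -(ler_pXn2r (ltn0Sn 1)) ?nnegrE ?normr_ge0 ?modulus_ge0//.
by rewrite modulus_sqr real_normK ?num_real// lerDr sqr_ge0.
Qed.

Lemma modulus_le_ReIm z : modulus z <= `|Re z| + `|Im z|.
Proof.
rewrite -(ler_pXn2r (ltn0Sn 1)) ?nnegrE ?addr_ge0 ?normr_ge0 ?modulus_ge0//.
rewrite modulus_sqr sqrrD !real_normK ?num_real// lerD2r lerDl.
by rewrite mulrn_wge0// mulr_ge0.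
Qed.

Definition cexp z : R[i] :=
  Complex (expR (Re z) * cos (Im z)) (expR (Re z) * sin (Im z)).

Lemma cexpD z w : cexp (z + w) = cexp z * cexp w.
Proof.
case: z w => [a b] [c d]; rewrite /cexp /= expRD cosD sinD.
by apply/eqP; rewrite eq_complex /=; apply/andP; split; apply/eqP; ring.
Qed.

Lemma cexpJ z : cexp (conjc z) = conjc (cexp z).
Proof. by case: z => a b; rewrite /cexp /= cosN sinN mulrN. Qed.

Lemma modulus_cexp z : modulus (cexp z) = expR (Re z).
Proof.
apply/eqP; rewrite -(eqrXn2 (ltn0Sn 1)) ?modulus_ge0 ?expR_ge0//.
by rewrite modulus_sqr /= !exprMn -mulrDr cos2Dsin2 mulr1.
Qed.

Lemma sin_MVT y : 0 <= y -> exists2 c, c \in `[0, y] & sin y = cos c * y.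
Proof.
move=> y0; have dsin x : x \in `]0, y[ -> is_derive x 1 (@sin R) (cos x).
  by move=> _; exact: is_derive_sin.
have csin : {within `[0, y], continuous (@sin R)}.
  exact/continuous_subspaceT/continuous_sin.
have [c cy] := MVT_segment y0 dsin csin.
by rewrite sin0 !subr0 => E; exists c.
Qed.

Lemma norm_sin_le y : `|sin y| <= `|y|.
Proof.
wlog y0 : y / 0 <= y => [H|].
  by have [/H//|/ltW y0] := leP 0 y; rewrite -normrN -sinN -[`|y|]normrN H// oppr_ge0.
have [c _ ->] := sin_MVT y0; rewrite normrM.
by rewrite -[leRHS]mul1r ler_wpM2r// cos_max.
Qed.

Lemma one_sub_cos_le y : `|cos y - 1| <= y ^+ 2 / 2.
Proof.
have := norm_sin_le (y / 2); set s := sin _ => sy.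
have {1}-> : y = (y / 2) *+ 2 by rewrite mulr2n; lra.
rewrite cos_mulr2n cos2sin2 -/s mulr2n.
have -> : 1 - s ^+ 2 + (1 - s ^+ 2) - 1 - 1 = - (2 * s ^+ 2) by ring.
rewrite normrN ger0_norm; last by rewrite mulr_ge0// sqr_ge0.
have := sqr_le_of_norm sy; rewrite real_normK ?num_real//; lra.
Qed.

Lemma sin_sub_le y : `|y| <= 1 -> `|sin y - y| <= y ^+ 2 / 2.
Proof.
wlog y0 : y / 0 <= y => [H|].
  have [/H//|/ltW y0 y1] := leP 0 y.
  by have := H (- y); rewrite normrN sqrrN sinN -opprD normrN oppr_ge0; apply.
move=> y1; have [c cy ->] := sin_MVT y0.
have -> : cos c * y - y = (cos c - 1) * y by ring.
move: cy y1; rewrite in_itv /= => /andP[c0 cy]; rewrite normrM (ger0_norm y0) => y1.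
have := one_sub_cos_le c.
have : c ^+ 2 <= y ^+ 2 by apply: sqr_le_of_norm; rewrite ger0_norm.
move=> cy2 h; rewrite -[leRHS]mulr1; apply: ler_pM => //; lra.
Qed.

Lemma expR_sub_le x : `|x| <= 2^-1 -> `|expR x - 1 - x| <= 2 * x ^+ 2.
Proof.
rewrite ler_norml => /andP[x1 x2].
have h1 := expR_ge1Dx x; have h2 := expR_ge1Dx (- x).
(* The upper bound comes from [expR x = (expR (- x))^-1 <= (1 - x)^-1]. *)
rewrite ger0_norm ?subr_ge0; last by lra.
suff : expR x <= 1 + x + 2 * x ^+ 2 by lra.
have : expR x * (1 - x) <= 1.
  rewrite -[leRHS](expRxMexpNx_1 x) ler_wpM2l ?expR_ge0//; lra.
move=> h; rewrite -(ler_pM2r (_ : 0 < 1 - x)); last by lra.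
apply: le_trans h _.
have -> : (1 + x + 2 * x ^+ 2) * (1 - x) = 1 + x ^+ 2 * (1 - 2 * x) by ring.
by rewrite lerDl mulr_ge0 ?sqr_ge0//; lra.
Qed.

(** The remainder splits as
    [(expR x - 1 - x) cos y + (1 + x) (cos y - 1)] in the real part and
    [(expR x - 1 - x) sin y + x sin y + (sin y - y)] in the imaginary part;
    every summand is of second order in the modulus of [w]. *)
Lemma cexp_second_order w : modulus w <= 2^-1 ->
  modulus (cexp w - 1 - w) <= 8 * modulus w ^+ 2.
Proof.
move=> w2; have rx := normr_Re_le w; have ry := normr_Im_le w.
have m0 := modulus_ge0 w.
apply: le_trans (modulus_le_ReIm _) _.
case: w w2 rx ry m0 => x y; set r := modulus _; rewrite /= => r2 xr yr r0.
have x2r : x ^+ 2 <= r ^+ 2 by exact: sqr_le_of_norm.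
have y2r : y ^+ 2 <= r ^+ 2 by exact: sqr_le_of_norm.
have ex : `|expR x - 1 - x| <= 2 * r ^+ 2.
  by apply: le_trans (expR_sub_le (le_trans xr r2)) _; lra.
have cy : `|cos y - 1| <= r ^+ 2 / 2 by apply: le_trans (one_sub_cos_le y) _; lra.
have sy : `|sin y - y| <= r ^+ 2 / 2.
  by apply: le_trans (sin_sub_le _) _; lra.
have -> : expR x * cos y - 1 - x =
  (expR x - 1 - x) * cos y + (1 + x) * (cos y - 1) by ring.
have -> : expR x * sin y - 0 - y =
  (expR x - 1 - x) * sin y + x * sin y + (sin y - y) by ring.
have A : `|(expR x - 1 - x) * cos y| <= 2 * r ^+ 2.
  by rewrite normrM -[leRHS]mulr1 ler_pM// cos_max.
have B : `|(1 + x) * (cos y - 1)| <= 2 * (r ^+ 2 / 2).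
  rewrite normrM ler_pM//; apply: le_trans (ler_normD _ _) _.
  by rewrite normr1; lra.
have C : `|(expR x - 1 - x) * sin y| <= 2 * r ^+ 2.
  by rewrite normrM -[leRHS]mulr1 ler_pM// sin_max.
have D : `|x * sin y| <= r ^+ 2.
  by rewrite normrM expr2 ler_pM// (le_trans (norm_sin_le y)).
have := ler_normD ((expR x - 1 - x) * cos y) ((1 + x) * (cos y - 1)).
have := ler_normD ((expR x - 1 - x) * sin y + x * sin y) (sin y - y).
have := ler_normD ((expR x - 1 - x) * sin y) (x * sin y).
have := sqr_ge0 r; lra.
Qed.

(** Complex differentiability with a remainder [O(k ^ 2)]. Every holomorphic
    function has this property; the explicit remainder makes it pass to
    infinite sums and to exponentials by plain estimates. *)
Definition quadratic_derivative (f : R[i] -> R[i]) z (l : R[i]) : Prop :=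
  exists C d : R, [/\ 0 <= C, 0 < d & forall k, modulus k < d ->
    modulus (f (z + k) - f z - l * k) <= C * modulus k ^+ 2].

(** The chain rule for [cexp], from the addition formula: with [x = f (z + k) - f z],
    [cexp (f (z + k)) = cexp (f z) * cexp x] and [x = l k + O(k ^ 2)]. *)
Lemma quadratic_derivative_cexp f z l : quadratic_derivative f z l ->
  quadratic_derivative (cexp \o f) z (cexp (f z) * l).
Proof.
move=> [C [d [C0 d0 H]]].
pose L := modulus l + C + 1; pose e := modulus (cexp (f z)).
have l0 := modulus_ge0 l; have e0 : 0 <= e := modulus_ge0 _.
have L0 : 0 < L by rewrite /L; lra.
exists (e * (8 * L ^+ 2 + C)), (Num.min d (Num.min 1 (2 * L)^-1)); split.
- by rewrite mulr_ge0// addr_ge0// mulr_ge0// sqr_ge0.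
- by rewrite !lt_min d0 ltr01 invr_gt0 mulr_gt0.
move=> k; rewrite !lt_min => /and3P[kd k1 kL]; set r := modulus k in k1 kL *.
have r0 : 0 <= r := modulus_ge0 _.
have {}H := H _ kd; rewrite -/r in H.
have [x xE] : exists x : R[i], x = f (z + k) - f z by eexists.
rewrite -xE in H.
have xL : modulus x <= L * r.
  have -> : x = (x - l * k) + l * k by rewrite subrK.
  apply: le_trans (modulusD _ _) _; rewrite modulusM -/r.
  have : C * r ^+ 2 <= C * r by rewrite ler_wpM2l// expr2 ler_piMr// ltW.
  by rewrite /L; nra.
have x2 : modulus x <= 2^-1.
  apply: le_trans xL _; move: kL; rewrite invfM => kL.
  have := ltW kL; rewrite -(ler_pM2l L0) mulrCA mulfV ?gt_eqF// mulr1 //.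
have -> : (cexp \o f) (z + k) - (cexp \o f) z - cexp (f z) * l * k =
    cexp (f z) * ((cexp x - 1 - x) + (x - l * k)).
  have -> : (cexp \o f) (z + k) = cexp (f z) * cexp x.
    by rewrite -cexpD xE [f z + _]addrC subrK.
  by rewrite /=; ring.
rewrite modulusM -/e -mulrA ler_wpM2l//; apply: le_trans (modulusD _ _) _.
rewrite mulrDl; apply: lerD => //.
apply: le_trans (cexp_second_order x2) _.
rewrite -mulrA -exprMn ler_wpM2l//; apply: sqr_le_of_norm.
by rewrite ger0_norm// modulus_ge0.
Qed.

End ComplexExponential.

(** * Open sets and nearest points in the complex plane *)
Section ComplexPlane.
Context {R : realType}.
Implicit Types (G : set R[i]^o) (z w p a : R[i]).
Local Notation Re := complex.Re.
Local Notation Im := complex.Im.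

Lemma nbhs_modulus (z : R[i]^o) (U : set R[i]^o) :
  nbhs z U <-> exists2 e : R, 0 < e & forall w, modulus (w - z) < e -> U w.
Proof.
split=> [/nbhs_ballP[[e b]]|[e e0 eU]].
  rewrite /= ltcE /= => /andP[/eqP-> e0] eU; exists e => // w we; apply: eU.
  by rewrite -ball_normE /= modulusE ltcR modulusB.
apply/nbhs_ballP; exists e%:C%C => /=; first by rewrite ltcR.
move=> w; rewrite -ball_normE /= modulusE ltcR modulusB; exact: eU.
Qed.

(** Pulls the complement of an open set back to a closed subset of [R * R], where
    squares are compact. *)
Lemma continuous_Complex :
  continuous ((fun x => Complex x.1 x.2) : R * R -> R[i]^o).
Proof.
move=> [x y] U /nbhs_modulus[e e0 eU].
apply/nbhs_ballP; exists (e / 2) => /=; first by rewrite divr_gt0.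
move=> [x' y'] [/= xx' yy']; apply: eU; apply: le_lt_trans (modulus_le_ReIm _) _.
rewrite -ball_normE /= in xx'; rewrite -ball_normE /= in yy'.
by rewrite /= (distrC x') (distrC y'); lra.
Qed.

(** The part of the complement of [G] in a large closed square centred at [p]
    is compact, so the distance to [p] has a minimum there. *)
Lemma nearest_point G : open G -> ~` G !=set0 -> forall p,
  exists2 a, ~ G a & forall w, ~ G w -> modulus (p - a) <= modulus (p - w).
Proof.
move=> oG [w0 Gw0] p; pose M := modulus (p - w0).
pose B : set (R * R) := `[Re p - M, Re p + M] `*` `[Im p - M, Im p + M].
pose K := B `&` (fun x : R * R => Complex x.1 x.2 : R[i]^o) @^-1` (~` G).
have inB w : modulus (p - w) <= M -> B (Re w, Im w).
  move=> wM; have := le_trans (normr_Re_le _) wM; have := le_trans (normr_Im_le _) wM.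
  have -> : Re (p - w) = Re p - Re w by case: (p) (w) => ? ? [].
  have -> : Im (p - w) = Im p - Im w by case: (p) (w) => ? ? [].
  rewrite !ler_norml => /andP[i1 i2] /andP[r1 r2].
  by split; rewrite /= in_itv /=; apply/andP; split; lra.
have inK w : ~ G w -> modulus (p - w) <= M -> K (Re w, Im w).
  by move=> Gw /inB Bw; split=> //; case: (w) Gw.
have K0 : K !=set0 by exists (Re w0, Im w0); apply: inK.
have cK : compact K.
  apply: compact_closedI; first by apply: compact_setX; exact: segment_compact.
  have /continuous_closedP := continuous_Complex; apply; exact: open_closedC.
(* The squared distance to [p], whose continuity is that of a polynomial. *)
pose D (x : R * R) : R :=
  (Re p - x.1) * (Re p - x.1) + (Im p - x.2) * (Im p - x.2).
have DE x y : D (x, y) = modulus (p - Complex x y) ^+ 2.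
  by rewrite /D modulus_sqr !expr2; case: (p).
have cD : continuous D.
  move=> x; have c1 : (fun x : R * R => Re p - x.1) @ x --> Re p - x.1.
    by apply: cvgB; [exact: cvg_cst|exact: cvg_fst].
  have c2 : (fun x : R * R => Im p - x.2) @ x --> Im p - x.2.
    by apply: cvgB; [exact: cvg_cst|exact: cvg_snd].
  by apply: cvgD; apply: cvgM.
have [[x y] /set_mem[_ /= Gxy] min] := compact_EVT_min K0 cK (continuous_subspaceT cD).
have {}min w : K (Re w, Im w) -> modulus (p - Complex x y) <= modulus (p - w).
  move=> Kw; have := min _ (mem_set Kw); rewrite !DE; case: (w) => c d /=.
  by rewrite ler_pXn2r ?nnegrE ?modulus_ge0.
exists (Complex x y) => // w Gw.
have [wM|/ltW Mw] := leP (modulus (p - w)) M; first by apply/min/inK.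
by apply: le_trans Mw; apply/min/inK.
Qed.
End ComplexPlane.

(** * Weighted sums of simple poles *)
Section PoleSums.
Context {R : realType}.
Implicit Types (u v c : nat -> R[i]) (z k : R[i]) (s : nat -> R).
Local Notation Re := complex.Re.
Local Notation Im := complex.Im.

Definition wsumC u : R[i] :=
  Complex (wsum (fun m => Re (u m))) (wsum (fun m => Im (u m))).

Definition bounded_seq u := exists M : R, forall m, modulus (u m) <= M.

Lemma boundedD u v : bounded_seq u -> bounded_seq v -> bounded_seq (fun m => u m + v m).
Proof.
move=> [M uM] [N vN]; exists (M + N) => m.
by apply: le_trans (modulusD _ _) _; exact: lerD.
Qed.

Lemma boundedZ k u : bounded_seq u -> bounded_seq (fun m => k * u m).
Proof.
move=> [M uM]; exists (modulus k * M) => m.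
by rewrite modulusM ler_wpM2l ?modulus_ge0.
Qed.

Lemma wsumCD u v : bounded_seq u -> bounded_seq v ->
  wsumC (fun m => u m + v m) = wsumC u + wsumC v.
Proof.
move=> [M uM] [N vN]; rewrite /wsumC.
have uR m := le_trans (normr_Re_le (u m)) (uM m).
have uI m := le_trans (normr_Im_le (u m)) (uM m).
have vR m := le_trans (normr_Re_le (v m)) (vN m).
have vI m := le_trans (normr_Im_le (v m)) (vN m).
rewrite -[RHS]/(Complex _ _) -(wsumD uR vR) -(wsumD uI vI).
by congr Complex; congr wsum; apply/funext => m; case: (u m) (v m) => ? ? [].
Qed.

Lemma wsumCZ k u : bounded_seq u -> wsumC (fun m => k * u m) = k * wsumC u.
Proof.
move=> [M uM]; rewrite /wsumC; case: k => x y.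
have uR m := le_trans (normr_Re_le (u m)) (uM m).
have uI m := le_trans (normr_Im_le (u m)) (uM m).
have b r (f : nat -> R) : (forall m, `|f m| <= M) -> forall m, `|r * f m| <= `|r| * M.
  by move=> fM m; rewrite normrM ler_wpM2l.
rewrite -[RHS]/(Complex _ _) -mulNr -!(wsumZ _ uR) -!(wsumZ _ uI).
rewrite -(wsumD (b x _ uR) (b (- y) _ uI)) -(wsumD (b x _ uI) (b y _ uR)).
by congr Complex; congr wsum; apply/funext => m; case: (u m) => ? ? /=; rewrite ?mulNr.
Qed.

Lemma modulus_wsumC M u : (forall m, modulus (u m) <= M) ->
  modulus (wsumC u) <= 4 * M.
Proof.
move=> uM; apply: le_trans (modulus_le_ReIm _) _.
have := wsum_norm_le (fun m => le_trans (normr_Re_le (u m)) (uM m)).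
have := wsum_norm_le (fun m => le_trans (normr_Im_le (u m)) (uM m)).
by rewrite /=; lra.
Qed.

Lemma wsumCJ u : bounded_seq u -> wsumC (fun m => conjc (u m)) = conjc (wsumC u).
Proof.
move=> [M uM]; rewrite /wsumC /= -mulN1r.
rewrite -(wsumZ _ (fun m => le_trans (normr_Im_le (u m)) (uM m))).
by congr Complex; congr wsum; apply/funext => m; case: (u m) => ? ? /=; rewrite ?mulN1r.
Qed.

Definition pole_sum s c z : R[i] := wsumC (fun m => (s m)%:C%C / (z - c m)).

Lemma modulus_real (x : R) : modulus x%:C%C = `|x|.
Proof. by rewrite /modulus /= expr0n /= addr0 sqrtr_sqr. Qed.

Section Derivative.
Variables (s : nat -> R) (c : nat -> R[i]) (z : R[i]) (d : R).
Hypotheses (s1 : forall m, `|s m| <= 1) (d0 : 0 < d)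
  (cd : forall m, d <= modulus (z - c m)).

Lemma modulus_pole_le m : modulus ((s m)%:C%C / (z - c m)) <= d^-1.
Proof.
rewrite modulusM modulusV modulus_real -[leRHS]mul1r ler_pM ?invr_ge0 ?modulus_ge0//.
by rewrite lef_pV2 ?posrE// (lt_le_trans d0).
Qed.

Lemma bounded_pole : bounded_seq (fun m => (s m)%:C%C / (z - c m)).
Proof. by exists d^-1 => m; exact: modulus_pole_le. Qed.

Lemma pole_sumJ : conjc (pole_sum s c z) = pole_sum s (conjc \o c) (conjc z).
Proof.
rewrite /pole_sum -wsumCJ; last exact: bounded_pole.
congr wsumC; apply/funext => m.
by rewrite rmorphM /= conjc_inv rmorphB /= oppr0.
Qed.

End Derivative.

(** With [w = z - c m], the remainder of a single pole is
    [s / (w + k) - s / w + k * s / w ^ 2 = s / (w + k) * (k / w) ^ 2], of modulus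
    at most [2 * modulus k ^ 2 / d ^ 3] for [modulus k < d / 2]. The bound is the
    same for all poles, hence survives the summation. *)
Lemma quadratic_derivative_pole_sum s c z d : (forall m, `|s m| <= 1) ->
  0 < d -> (forall m, d <= modulus (z - c m)) ->
  quadratic_derivative (pole_sum s c) z
    (- wsumC (fun m => (s m)%:C%C / (z - c m) / (z - c m))).
Proof.
move=> s1 d0 cd.
have i0 : 0 <= d^-1 by rewrite invr_ge0 ltW.
have nz m : z - c m != 0.
  by apply/eqP => zc; have := cd m; rewrite zc modulus0 leNgt d0.
exists (4 * (2 * d^-1 * d^-1 * d^-1)), (d / 2); split.
- by rewrite !mulr_ge0.
- by rewrite divr_gt0.
move=> k kd.
have cd2 m : d / 2 <= modulus (z + k - c m).
  have := modulusD (z + k - c m) (- k); rewrite modulusN.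
  have -> : z + k - c m - k = z - c m by ring.
  by have := cd m; lra.
have d20 : 0 < d / 2 by rewrite divr_gt0.
have nz2 m : z + k - c m != 0.
  by apply/eqP => zc; have := cd2 m; rewrite zc modulus0 leNgt d20.
pose A m := (s m)%:C%C / (z + k - c m); pose B m := (s m)%:C%C / (z - c m).
pose D m := (s m)%:C%C / (z - c m) / (z - c m).
have bA : bounded_seq A := bounded_pole s1 d20 cd2.
have bB : bounded_seq B := bounded_pole s1 d0 cd.
have bD : bounded_seq D.
  exists (d^-1 * d^-1) => m; rewrite /D modulusM ler_pM ?modulus_ge0//.
    exact: modulus_pole_le.
  by rewrite modulusV lef_pV2 ?posrE// (lt_le_trans d0).
rewrite /pole_sum -/A -/B -/D mulNr opprK (mulrC _ k).
have -> : wsumC A - wsumC B + k * wsumC D =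
    wsumC (fun m => A m + (-1) * B m + k * D m).
  rewrite !wsumCD ?wsumCZ//; first by ring.
  - exact: boundedZ.
  - by apply: boundedD => //; exact: boundedZ.
  - exact: boundedZ.
rewrite -[4 * _ * _]mulrA; apply: modulus_wsumC => m.
have -> : A m + -1 * B m + k * D m =
    A m * ((k / (z - c m)) * (k / (z - c m))).
  rewrite /A /B /D; field; by rewrite nz nz2.
rewrite [modulus (A m * _)]modulusM.
have -> : modulus (k / (z - c m) * (k / (z - c m))) =
  (modulus k / modulus (z - c m)) * (modulus k / modulus (z - c m)).
  by rewrite !modulusM modulusV.
have := modulus_pole_le s1 d20 cd2 m; rewrite -/(A m) invfM invrK => Am.
have ci : (modulus (z - c m))^-1 <= d^-1 by rewrite lef_pV2 ?posrE// (lt_le_trans d0).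
have ci0 : 0 <= (modulus (z - c m))^-1 by rewrite invr_ge0 modulus_ge0.
have k0 := modulus_ge0 k.
have -> : 2 / d / d / d * modulus k ^+ 2 =
  (d^-1 * 2) * ((modulus k / d) * (modulus k / d)) by ring.
have q : modulus k / modulus (z - c m) <= modulus k / d by rewrite ler_wpM2l.
have q0 : 0 <= modulus k / modulus (z - c m) by rewrite mulr_ge0.
apply: ler_pM => //; [exact: modulus_ge0|exact: mulr_ge0|exact: ler_pM].
Qed.

End PoleSums.

(** * Blow-up of a sum of poles at each of its poles *)
Section BoundaryBlowUp.
Context {R : realType}.
Local Notation Re := complex.Re.
Local Notation Im := complex.Im.

Lemma Re_invC (z : R[i]) : Re z^-1 = Re z / modulus z ^+ 2.
Proof. by rewrite modulus_sqr; case: z. Qed.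

Lemma Re_realM (x : R) (z : R[i]) : Re (x%:C%C * z) = x * Re z.
Proof. by case: z => a b /=; rewrite mul0r subr0. Qed.

Section Approach.
Variables (d : R[i]) (s : R).
Hypotheses (d0 : d != 0) (s1 : s * s = 1) (sd : 0 <= s * Re d).
Let r := modulus d.
(** The direction in which a pole [a] is approached inside a disc that has [a] on
    its rim and centre [a + d]. Going straight to the centre is not good enough:
    if [a] is real and [d] purely imaginary, a real multiple of [(z - a)^-1] is
    purely imaginary along that ray. Adding a real number of size [modulus d]
    with the sign [s] of [Re d] tilts the ray by at most 45 degrees, which keeps
    it inside the disc and makes the real part of [s / (z - a)] comparable to its
    modulus. *)
Definition approach : R[i] := d + (s * modulus d)%:C%C.

Let r0 : 0 < r. Proof. exact: modulus_gt0. Qed.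

Let s_norm : `|s| = 1.
Proof.
apply/eqP; rewrite -(eqrXn2 (ltn0Sn 1)) ?normr_ge0// expr1n.
by rewrite real_normK ?num_real// expr2 s1.
Qed.

Lemma modulus_approach_le : modulus approach <= 2 * r.
Proof.
apply: le_trans (modulusD _ _) _; rewrite modulus_real normrM s_norm mul1r.
by rewrite ger0_norm ?modulus_ge0// -/r; lra.
Qed.

Lemma Re_approach_ge : r <= s * Re approach.
Proof.
rewrite /approach -/r (_ : Re _ = Re d + s * r); last by case: (d).
by rewrite mulrDr mulrA s1 mul1r lerDr.
Qed.

(** Since [Re (d^* * approach) >= modulus d ^ 2], moving by [t * approach] brings
    the point closer to the centre at a linear rate; hence its distance to the
    outside of the disc is at least [modulus d * t / 2]. *)
Lemma approach_in_disc t : 0 <= t <= 4^-1 ->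
  modulus (d - t%:C%C * approach) <= r * (1 - t / 2).
Proof.
move=> /andP[t0 t1]; rewrite -(ler_pXn2r (ltn0Sn 1)) ?nnegrE ?modulus_ge0//; last first.
  by rewrite mulr_ge0 ?modulus_ge0//; lra.
rewrite modulus_sqr /approach -/r; have := modulus_sqr d; rewrite -/r.
move: sd r0; case: (d) => x y; rewrite /= => sx rp rE.
rewrite !mul0r !addr0 subr0.
have -> : (x - t * (x + s * r)) ^+ 2 + (y - t * y) ^+ 2 =
  (x ^+ 2 + y ^+ 2) * (1 - t) ^+ 2 - 2 * ((1 - t) * t * r) * (s * x) +
  t ^+ 2 * r ^+ 2 * (s * s) by ring.
rewrite -rE s1 mulr1 exprMn.
have A : 0 <= 2 * ((1 - t) * t * r) * (s * x).
  by do ?apply: mulr_ge0 => //; lra.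
have B : 0 <= r ^+ 2 * (t * (1 - 7 / 4 * t)).
  by do ?apply: mulr_ge0 => //; lra.
lra.
Qed.

Lemma Re_pole_approach t : 0 < t ->
  (4 * r * t)^-1 <= Re (s%:C%C / (t%:C%C * approach)).
Proof.
move=> t0; have w0 : 0 < modulus approach.
  apply: lt_le_trans r0 _; apply: le_trans Re_approach_ge _.
  apply: le_trans (ler_norm _) _; rewrite normrM s_norm mul1r; exact: normr_Re_le.
rewrite Re_realM Re_invC Re_realM modulusM modulus_real (gtr0_norm t0).
have -> : s * (t * Re approach / (t * modulus approach) ^+ 2) =
    (s * Re approach) / (t * modulus approach ^+ 2).
  by field; rewrite !gt_eqF.
have -> : (4 * r * t)^-1 = r / (t * (2 * r) ^+ 2).
  by field; rewrite !gt_eqF.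
apply: ler_pM; rewrite ?invr_ge0; [exact: ltW| |exact: Re_approach_ge|].
  by rewrite mulr_ge0 ?ltW// exprn_gt0// mulr_gt0.
rewrite lef_pV2 ?posrE ?mulr_gt0 ?exprn_gt0 ?mulr_gt0// ler_pM2l//.
apply: sqr_le_of_norm; rewrite ger0_norm ?modulus_ge0//; exact: modulus_approach_le.
Qed.

End Approach.

Lemma finite_separation (f : nat -> R[i]) (a : R[i]) (n : nat) :
  exists2 e : R, 0 < e & forall m, (m < n)%N -> f m != a -> e <= modulus (a - f m).
Proof.
elim: n => [|n [e e0 eP]]; first by exists 1.
have [fa|fa] := eqVneq (f n) a.
  exists e => // m; rewrite ltnS leq_eqVlt => /orP[/eqP->|]; last exact: eP.
  by rewrite fa eqxx.
have q0 : 0 < modulus (a - f n) by rewrite modulus_gt0// subr_eq0 eq_sym.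
exists (Num.min e (modulus (a - f n))); first by rewrite lt_min e0.
move=> m; rewrite ltnS leq_eqVlt ge_min => /orP[/eqP-> _|mn fm].
  by rewrite lexx orbT.
by rewrite eP.
Qed.

Variables (G : set R[i]^o) (a p : nat -> R[i]).
Hypotheses (GJ : forall z, G z <-> G (conjc z)) (oG : open G)
  (Ga : forall m, ~ G (a m)) (Gp : forall m, G (p m))
  (near_a : forall m w, ~ G w -> modulus (p m - a m) <= modulus (p m - w)).

Let s m : R := if 0 <= Re (p m - a m) then 1 else -1.

Let s1 m : s m * s m = 1.
Proof. by rewrite /s; case: ifP => _; rewrite ?mulrNN mulr1. Qed.

Let s_le1 m : `|s m| <= 1.
Proof. by rewrite /s; case: ifP => _; rewrite ?normrN normr1. Qed.

Let sd m : 0 <= s m * Re (p m - a m).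
Proof.
rewrite /s; case: ifP => [|/negbT]; first by rewrite mul1r.
by rewrite -ltNge mulN1r oppr_ge0 => /ltW.
Qed.

Let GaJ m : ~ G (conjc (a m)).
Proof. by rewrite -GJ; exact: Ga. Qed.

(** The coefficients [s m] are real, so that adding the conjugate poles yields a
    function commuting with conjugation. *)
Definition barrier z : R[i] := pole_sum s a z + pole_sum s (conjc \o a) z.

Let separated z : G z ->
  exists2 d : R, 0 < d & forall w, ~ G w -> d <= modulus (z - w).
Proof.
move=> Gz; have /nbhs_modulus[d d0 dG] : nbhs (z : R[i]^o) G by exact: open_nbhs_nbhs.
exists d => // w Gw; rewrite leNgt; apply/negP => wd; apply: Gw; apply: dG.
by rewrite modulusB.
Qed.

Lemma quadratic_derivative_barrier z :
  G z -> exists l, quadratic_derivative barrier z l.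
Proof.
move=> /separated[d d0 dG].
have [C1 [d1 [C10 d10 H1]]] :=
  quadratic_derivative_pole_sum s_le1 d0 (fun m => dG _ (@Ga m)).
have [C2 [d2 [C20 d20 H2]]] := @quadratic_derivative_pole_sum _ _ (conjc \o a)
  _ _ s_le1 d0 (fun m => dG _ (@GaJ m)).
move: H1 H2; set l1 := - wsumC _; set l2 := - wsumC _ => H1 H2.
exists (l1 + l2), (C1 + C2), (Num.min d1 d2); split.
- exact: addr_ge0.
- by rewrite lt_min d10.
move=> k; rewrite lt_min => /andP[k1 k2].
have -> : barrier (z + k) - barrier z - (l1 + l2) * k =
  (pole_sum s a (z + k) - pole_sum s a z - l1 * k) +
  (pole_sum s (conjc \o a) (z + k) - pole_sum s (conjc \o a) z - l2 * k).
  by rewrite /barrier; ring.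
rewrite mulrDl; apply: le_trans (modulusD _ _) _; apply: lerD; [exact: H1|exact: H2].
Qed.

Lemma barrierJ z : G z -> barrier (conjc z) = conjc (barrier z).
Proof.
move=> /separated[d d0 dG]; have J1 := pole_sumJ s_le1 d0 (fun m => dG _ (@Ga m)).
have J2 := @pole_sumJ _ _ (conjc \o a) _ _ s_le1 d0 (fun m => dG _ (@GaJ m)).
have aJJ : (conjc \o (conjc \o a)) = a by apply/funext => m /=; rewrite conjcK.
rewrite aJJ in J2.
have -> : conjc (barrier z) =
    conjc (pole_sum s a z) + conjc (pole_sum s (conjc \o a) z).
  exact: (rmorphD (@conjc R)).
by rewrite J1 J2 addrC.
Qed.

(** If [a n] occurs, up to conjugation, at no earlier index, then on the tilted ray
    [z = a n + t * w], with [r = modulus (p n - a n)], the [n]th term has real part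
    at least [(4 * r * t)^-1 - O(1)]. The terms of index [m < n] stay bounded,
    because their poles keep away from [a n]. No other pole is closer to [z] than
    [r * t / 2], so the later terms are at most [4 / (r * t)] in modulus, and their
    total weight is too small to compensate the [n]th one. *)
Lemma barrier_blow_up_first n (M e : R) : 0 < e ->
  (forall m, (m < n)%N -> a m != a n /\ conjc (a m) != a n) ->
  exists z, [/\ G z, modulus (z - a n) < e & M < Re (barrier z)].
Proof.
move=> e0 first_n; pose d := p n - a n; pose r := modulus d.
have d0 : d != 0.
  apply/eqP => /subr0_eq pa; apply: (@Ga n); rewrite -pa; exact: Gp.
have r0 : 0 < r by exact: modulus_gt0.
have [e1 e10 sep1] := finite_separation a (a n) n.
have [e2 e20 sep2] := finite_separation (conjc \o a) (a n) n.+1.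
(* [q] separates [a n] from the poles of index below [n] and their conjugates, and
   from its own conjugate unless [a n] is real. *)
have [q [q0 qe1 qe2]] : exists q : R, [/\ 0 < q, q <= e1 & q <= e2].
  by exists (Num.min e1 e2); rewrite lt_min e10 e20 !ge_min !lexx orbT.
(* The lower bound obtained at the end is
     [64 ^- n * ((8 * r * t)^-1 - 2 / q) - 8 / q]; it exceeds [M] as soon as
     [(8 * r * t)^-1] is at least [X]. *)
pose X := Num.max 1 ((M + 8 / q) * 64 ^+ n + 2 / q + 1).
have X0 : 0 < X by rewrite lt_max ltr01.
have XM : (M + 8 / q) * 64 ^+ n + 2 / q < X by rewrite lt_max; apply/orP; right; lra.
clearbody X; have [t [t0 t4 tq te tX]] : exists t : R,
  [/\ 0 < t, t <= 4^-1, 2 * (t * (2 * r)) <= q, t * (2 * r) < e &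
      X <= (8 * r * t)^-1].
  have A1 : 0 < q / (4 * r) by rewrite divr_gt0// mulr_gt0.
  have A2 : 0 < e / (4 * r) by rewrite divr_gt0// mulr_gt0.
  have A3 : 0 < (8 * r * X)^-1 by rewrite invr_gt0 !mulr_gt0.
  exists (Num.min 4^-1
    (Num.min (q / (4 * r)) (Num.min (e / (4 * r)) (8 * r * X)^-1))).
  set t := Num.min _ _.
  have t0 : 0 < t by rewrite !lt_min invr_gt0 A1 A2 A3 ltr0n.
  have : t <= t by []; rewrite {2}/t !le_min => /and4P[t4 tq te tX].
  clearbody t; split=> //.
  - by move: tq; rewrite ler_pdivlMr ?mulr_gt0//; lra.
  - by move: te; rewrite ler_pdivlMr ?mulr_gt0//; have := mulr_gt0 t0 r0; lra.
  - rewrite -[leLHS]invrK lef_pV2 ?posrE ?invr_gt0 ?mulr_gt0//.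
    rewrite invfM in tX; rewrite -ler_pdivlMl ?mulr_gt0//.
pose w := approach d (s n); pose z := a n + t%:C%C * w.
have tw : modulus (t%:C%C * w) <= t * (2 * r).
  by rewrite modulusM modulus_real gtr0_norm// ler_wpM2l ?(ltW t0)// modulus_approach_le.
have pz : modulus (p n - z) <= r * (1 - t / 2).
  have -> : p n - z = d - t%:C%C * w by rewrite /z /d; ring.
  by apply: approach_in_disc => //; rewrite (ltW t0) t4.
have rt := mulr_gt0 r0 t0.
have Gz : G z.
  by apply: contrapT => /(@near_a n _); rewrite -/d -/r; lra.
have zw c : ~ G c -> r * t / 2 <= modulus (z - c).
  move=> /(@near_a n _); rewrite -/d -/r.
  have := modulusD (p n - z) (z - c); have -> : p n - z + (z - c) = p n - c by ring.
  lra.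
have rt2 : 0 < r * t / 2 by rewrite divr_gt0.
have pole_le m c : ~ G c -> modulus ((s m)%:C%C / (z - c)) <= 2 / (r * t).
  have -> : 2 / (r * t) = (r * t / 2)^-1 by rewrite [RHS]invfM invrK mulrC.
  by move=> /zw zc; exact: (@modulus_pole_le _ s (fun=> c) z _ s_le1 rt2 (fun=> zc)).
have far_pole m c :
    q <= modulus (a n - c) -> modulus ((s m)%:C%C / (z - c)) <= 2 / q.
  have -> : 2 / q = (q / 2)^-1 by rewrite invfM invrK mulrC.
  move=> qc; have q20 : 0 < q / 2 by rewrite divr_gt0.
  suff zc : q / 2 <= modulus (z - c).
    exact: (@modulus_pole_le _ s (fun=> c) z _ s_le1 q20 (fun=> zc)).
  have := modulusD (z - c) (- (t%:C%C * w)); rewrite modulusN.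
  have -> : z - c - t%:C%C * w = a n - c by rewrite /z; ring.
  lra.
pose u m := Re ((s m)%:C%C / (z - a m)) + Re ((s m)%:C%C / (z - conjc (a m))).
have barrierE : Re (barrier z) = wsum u.
  rewrite /barrier /pole_sum /wsumC /u.
  rewrite (@wsumD _ (2 / (r * t)) (2 / (r * t))) //.
    by move=> m; apply: le_trans (normr_Re_le _) _; exact/pole_le/Ga.
  by move=> m; apply: le_trans (normr_Re_le _) _; exact/pole_le/GaJ.
have u_le m : `|u m| <= 4 / (r * t).
  apply: le_trans (ler_normD _ _) _.
  have := le_trans (normr_Re_le _) (pole_le m _ (@Ga m)).
  have := le_trans (normr_Re_le _) (pole_le m _ (@GaJ m)).
  lra.
have u_far m : (m < n)%N -> - (4 / q) <= u m.
  move=> mn; have [am cam] := first_n m mn.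
  have am1 : q <= modulus (a n - a m) by exact/(le_trans qe1)/sep1.
  have am2 : q <= modulus (a n - conjc (a m)).
    by apply/(le_trans qe2)/(sep2 m) => //; exact: ltn_trans mn _.
  have := le_trans (normr_Re_le _) (far_pole m _ am1).
  have := le_trans (normr_Re_le _) (far_pole m _ am2).
  by rewrite !ler_norml => /andP[? _] /andP[? _]; rewrite /u; lra.
have u_n : (4 * r * t)^-1 - 2 / q <= u n.
  have main : (4 * r * t)^-1 <= Re ((s n)%:C%C / (z - a n)).
    have -> : z - a n = t%:C%C * w by rewrite /z; ring.
    exact: Re_pole_approach.
  (* A real pole occurs twice with the same sign, so its two terms add up. *)
  have [cn|cn] := eqVneq (conjc (a n)) (a n).
    rewrite /u cn; have : 0 < (4 * r * t)^-1 by rewrite invr_gt0 !mulr_gt0.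
    have : 0 < 2 / q by rewrite divr_gt0.
    lra.
  have am2 : q <= modulus (a n - conjc (a n)).
    exact/(le_trans qe2)/(sep2 n).
  have := le_trans (normr_Re_le _) (far_pole n _ am2).
  by rewrite ler_norml => /andP[? _]; rewrite /u; lra.
exists z; split=> //.
  have -> : z - a n = t%:C%C * w by rewrite /z; ring.
  exact: le_lt_trans tw te.
rewrite barrierE; have q4 : 0 <= 4 / q by rewrite divr_ge0// ltW.
have := wsum_ge u_le q4 u_far u_n (fun m _ => u_le m).
(* Half of the main term [(4 * r * t)^-1] is absorbed by the later poles. *)
have E1 : (4 * r * t)^-1 = 2 * (8 * r * t)^-1 by field; rewrite !gt_eqF.
have E2 : 4 / (r * t) = 32 * (8 * r * t)^-1 by field; rewrite !gt_eqF.
rewrite E1 E2; apply: lt_le_trans.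
have K0 : 0 < 64^-1 ^+ n :> R by rewrite exprn_gt0// invr_gt0.
have K1 : 64^-1 ^+ n * 64 ^+ n = 1 :> R by rewrite -exprMn mulVf ?expr1n ?gt_eqF.
have K2 : 64^-1 ^+ n * ((M + 8 / q) * 64 ^+ n + 2 / q) < 64^-1 ^+ n * X.
  by rewrite ltr_pM2l.
have K3 : 64^-1 ^+ n * X <= 64^-1 ^+ n * (8 * r * t)^-1 by rewrite ler_pM2l.
have K4 : 64^-1 ^+ n * ((M + 8 / q) * 64 ^+ n) = M + 8 / q.
  by rewrite mulrCA K1 mulr1.
rewrite mulrDr K4 in K2.
move: K2 K3; set T := (8 * r * t)^-1; set P := 64^-1 ^+ n; set Q := q^-1 => K2 K3.
have -> : P * (2 * T - 2 * Q - 32 * T / 32) = P * T - P * (2 * Q) by field.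
lra.
Qed.

(** Reduction to the first index at which [a n] or its conjugate occurs; in the
    second case the blow-up is transported by conjugation. *)
Lemma barrier_blow_up n (M e : R) : 0 < e ->
  exists z, [/\ G z, modulus (z - a n) < e & M < Re (barrier z)].
Proof.
move=> e0; pose P m := (a m == a n) || (conjc (a m) == a n).
have exP : exists m, P m by exists n; rewrite /P eqxx.
have [m Pm min_m] := ex_minnP exP.
have first_m k : (k < m)%N -> a k != a m /\ conjc (a k) != a m.
  move=> km; have : ~~ P k by apply/negP => /min_m; rewrite leqNgt km.
  rewrite /P negb_or => /andP[k1 k2].
  case/orP: Pm => /eqP E; first by rewrite E.
  split; apply/negP => /eqP F.
    by move: k2; rewrite F E eqxx.
  by move: k1; rewrite -E -F conjcK eqxx.
have [z [Gz za Mz]] := barrier_blow_up_first M e0 first_m.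
case/orP: Pm => /eqP E; first by exists z; rewrite -E.
exists (conjc z); split; first by rewrite -GJ.
  by rewrite -E -rmorphB /= modulusJ.
by rewrite barrierJ//; case: (barrier z) Mz.
Qed.

End BoundaryBlowUp.

(** * The barrier function of a symmetric open set *)
Section ExistsBarrier.
Context {R : realType}.
Local Notation Re := complex.Re.
Local Notation Im := complex.Im.

Lemma rat_dense_complex (z : R[i]) (e : R) : 0 < e ->
  exists x y : rat, modulus (Complex (ratr x) (ratr y) - z) < e.
Proof.
move=> e0; have dense (t : R) : exists x : rat, `|ratr x - t| < e / 2.
  have [|x] := @rat_in_itvoo R (t - e / 2) (t + e / 2); first by lra.
  rewrite in_itv /= => /andP[x1 x2]; exists x.
  by rewrite ltr_norml; apply/andP; split; lra.
have [x xz] := dense (Re z); have [y yz] := dense (Im z).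
exists x, y; apply: le_lt_trans (modulus_le_ReIm _) _.
by case: z xz yz => a b /=; lra.
Qed.

(** The poles are the points of the complement nearest to the rational points [p m]
    of [G]. They are dense in the boundary: a rational point of [G] close to a
    boundary point [b] has a nearest point at most as far away as [b]. *)
Lemma exists_barrier (G : set R[i]^o) :
  G !=set0 -> open G -> (forall z, G z <-> G (conjc z)) ->
  exists h : R[i] -> R[i],
    [/\ forall z, G z -> exists l, quadratic_derivative h z l,
        forall z, G z -> h (conjc z) = conjc (h z) &
        forall b, ~ G b -> closure G b -> forall M e : R, 0 < e ->
          exists z, [/\ G z, modulus (z - b) < e & M < Re (h z)]].
Proof.
move=> [z0 Gz0] oG GJ.
have [nG|/set0P/negP/negPn/eqP nG] := pselect (~` G !=set0); last first.
  have GT z : G z by apply: contrapT => Gz; have : set0 z by rewrite -nG.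
  exists (fun=> 0); split=> [z _|z _|b /(_ (GT b))//].
    exists 0, 0, 1; split=> // k _.
    by rewrite subr0 mul0r subr0 modulus0 mul0r.
  exact: (esym (conjc0 R)).
have near_ex p : exists a,
    ~ G a /\ forall w, ~ G w -> modulus (p - a) <= modulus (p - w).
  by have [a Ga ap] := nearest_point oG nG p; exists a.
(* An enumeration of the rational points of [G]; the other values are [z0]. *)
pose p m : R[i] := if unpickle m is Some (x, y) then
    let q : R[i] := Complex (ratr x) (ratr y) in if `[< G q >] then q else z0
  else z0.
have Gp m : G (p m).
  by rewrite /p; case: (unpickle m) => // -[x y]; case: asboolP.
have [a Pa] := choice (fun m => near_ex (p m)).
have Ga m := (Pa m).1; have pa m := (Pa m).2.
exists (barrier a p); split.
- by move=> z; exact: quadratic_derivative_barrier.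
- by move=> z; exact: barrierJ.
move=> b Gb clGb M e e0.
have e80 : 0 < e / 8 by rewrite divr_gt0.
have [z [Gz /= zb]] : G `&` [set z | modulus (z - b) < e / 8] !=set0.
  by apply: clGb; apply/nbhs_modulus; exists (e / 8).
have /nbhs_modulus[d d0 dG] : nbhs (z : R[i]^o) G by exact: open_nbhs_nbhs.
have de0 : 0 < Num.min d (e / 8) by rewrite lt_min d0.
have [x [y]] := rat_dense_complex z de0.
rewrite lt_min => /andP[qd qe].
pose m := pickle (x, y).
have pm : p m = Complex (ratr x) (ratr y).
  by rewrite /p /m pickleK; case: asboolP => // -[]; exact: dG.
have [w [Gw wa Mw]] := barrier_blow_up GJ oG Ga Gp pa m M e80.
exists w; split=> //.
have pb : modulus (p m - b) < e / 4.
  have -> : p m - b = (p m - z) + (z - b) by ring.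
  by apply: le_lt_trans (modulusD _ _) _; rewrite pm; lra.
have ap : modulus (a m - p m) < e / 4.
  by rewrite modulusB; exact: le_lt_trans (pa m _ Gb) pb.
have -> : w - b = (w - a m) + (a m - p m) + (p m - b) by ring.
have := modulusD (w - a m + (a m - p m)) (p m - b).
have := modulusD (w - a m) (a m - p m).
lra.
Qed.

Local Open Scope quotient_scope.

(** Otherwise the image of [G] in the quotient of [H] by conjugation would be open,
    closed and non-empty, hence everything. *)
Lemma exists_frontier_point (G H : set R[i]^o) :
  G !=set0 -> open G -> (forall z, G z <-> G (conjc z)) ->
  symmetric_domain H -> G `<=` H -> ~ (H `<=` G) ->
  exists b, [/\ H b, ~ G b & closure G b].
Proof.
move=> [z0 Gz0] oG GJ [_ oH HJ cH] GH HG; apply: contrapT => nb; apply: HG => z Hz.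
have clG b : H b -> closure G b -> G b.
  by move=> Hb cb; apply: contrapT => Gb; apply: nb; exists b.
pose U : set (conj_quotient H) := [set q | G (val (repr q))].
have piU (x : H) : U (\pi_(conj_quotient H) x) <-> G (val x).
  rewrite /U /=.
  have : repr (\pi_(conj_quotient H) x) = x %[mod {eq_quot conj_equiv H}].
    by rewrite reprK.
  move/eqmodP; rewrite /= /conj_rel => /orP[/eqP->//|/eqP->].
  by rewrite -GJ.
have cval : continuous (set_val : H -> R[i]^o) by exact: initial_continuous.
have UT : U = setT.
  apply: cH.
  - by exists (\pi_(conj_quotient H) (exist _ z0 (mem_set (GH _ Gz0)))); apply/piU.
  - exists U; rewrite ?setTI//.
    rewrite /open /= /quotient_open (_ : _ @^-1` _ = set_val @^-1` G); last first.
      by apply/seteqP; split=> x /piU.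
    by move/continuousP : cval; apply.
  (* Closedness: inside [H] the closure of [G] adds no point to [G]. *)
  - exists U; rewrite ?setTI//; rewrite -openC.
    rewrite /open /= /quotient_open.
    rewrite (_ : _ @^-1` _ = set_val @^-1` (~` closure G)); last first.
      apply/seteqP; split=> x /=.
        by move=> Ux cx; apply/Ux/piU/clG => //; case: (x) => ? /= /set_mem.
      by move=> cx /piU Gx; apply: cx; exact: subset_closure.
    move/continuousP : cval; apply; rewrite openC; exact: closed_closure.
have /piU : U (\pi_(conj_quotient H) (exist _ z (mem_set Hz))) by rewrite UT.
by [].
Qed.

End ExistsBarrier.

(** * Slice functions with values in the planes [R + R I] *)
Section InducedFunction.
Context {R : realType} {A : altStarAlgType R}.
Implicit Types (I J : A) (x y : R) (phi : R[i] -> R[i]) (G : set R[i]^o).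
Local Notation Re := complex.Re.
Local Notation Im := complex.Im.

Lemma areal_inj : injective (@areal R A).
Proof.
move=> x y /eqP; rewrite /areal -subr_eq0 -scalerBl scaler_eq0.
by rewrite (negPf aone_neq0) orbF subr_eq0 => /eqP.
Qed.

Lemma pseudosphereN I : pseudosphere A I -> pseudosphere A (- I).
Proof.
move=> /pseudosphereP[cI II]; apply/pseudosphereP.
by rewrite -scaleN1r aconjZ cI !scaleN1r amulNl amulNr !opprK.
Qed.

(** The involution separates the real part from the imaginary part [y I], and the
    square [- y ^ 2] of the latter determines [y] up to sign. *)
Lemma slice_point_inj x y x' y' I J :
  pseudosphere A I -> pseudosphere A J ->
  slice_point x y I = slice_point x' y' J ->
  x = x' /\ (y = y' /\ (y = 0 \/ I = J) \/ y = - y' /\ I = - J).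
Proof.
move=> SI SJ E; have [cI II] := (pseudosphereP I).1 SI.
have [cJ JJ] := (pseudosphereP J).1 SJ.
have xx : x = x'.
  have := congr1 aconj E; rewrite !aconj_slice// => E'.
  have := congr2 +%R E E'; rewrite /slice_point !scaleNr.
  rewrite addrACA subrr addr0 addrACA subrr addr0 /areal -!scalerDl => /areal_inj.
  lra.
split=> //; move: E; rewrite /slice_point xx => /addrI E.
have : y ^+ 2 = y' ^+ 2.
  have := congr2 amul E E; rewrite !(amulZl, amulZr) II JJ !scalerA.
  by rewrite !scalerN => /oppr_inj/areal_inj; rewrite !expr2.
move=> /eqP; rewrite eqf_sqr => /orP[]/eqP yy.
  left; split=> //; have [->|y0] := eqVneq y 0; [by left|right].
  by move: E; rewrite -yy => /(scalerI y0).
have [y0|y0] := eqVneq y 0.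
  by left; rewrite y0; split; [move: yy; rewrite y0 => yy; lra|left].
right; split=> //; apply: (scalerI y0); rewrite E yy scalerN scaleNr opprK //.
Qed.

(** The two descriptions [x + y I] and [x + (- y) (- I)] of a point give the same
    value because [phi] commutes with conjugation; for the same reason [phi] is
    real at real points, where [I] is arbitrary. *)
Lemma induced_function_exists phi G :
  (forall z, G z -> phi (conjc z) = conjc (phi z)) ->
  exists f : A -> A, forall x y I, G (Complex x y) -> pseudosphere A I ->
    f (slice_point x y I) =
      slice_point (Re (phi (Complex x y))) (Im (phi (Complex x y))) I.
Proof.
move=> phiJ.
suff /choice[f fP] : forall q : A, exists v : A, forall x y I,
    G (Complex x y) -> pseudosphere A I -> q = slice_point x y I ->
    v = slice_point (Re (phi (Complex x y))) (Im (phi (Complex x y))) I.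
  by exists f => x y I Gz SI; exact: fP.
move=> q; have [|nq] := pselect (axial_domain A G q); last first.
  by exists 0 => x y I Gz SI qE; case: nq; exists x, y, I.
move=> [x [y [I [Gz SI ->]]]].
exists (slice_point (Re (phi (Complex x y))) (Im (phi (Complex x y))) I).
move=> x' y' J Gz' SJ /(slice_point_inj SI SJ)[xx]; subst x'.
case=> [[<- [y0|->//]]|[-> ->]].
  have := phiJ _ Gz; rewrite y0 /= oppr0; case: (phi _) => a b [] b0.
  have -> : b = 0 by lra.
  by rewrite /slice_point /= !scale0r.
have := phiJ _ Gz'; rewrite /= => ->; case: (phi _) => a b /=.
by rewrite /slice_point scalerN scaleNr opprK.
Qed.

(** A complex-valued function, with [R[i]] embedded in the complexification as
    the span of [1] over [R[i]]. *)
Definition real_stem phi (z : R[i]^o) : complexification A :=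
  (Re (phi z) *: aone, Im (phi z) *: aone).

Lemma continuous_Re : continuous (@complex.Re R : R[i]^o -> R).
Proof.
move=> z U /nbhs_ballP[e e0 eU]; apply/nbhs_modulus; exists e => // w we.
apply: eU; rewrite -ball_normE /=.
apply: le_lt_trans we; rewrite modulusB; apply: le_trans (normr_Re_le _).
by case: (z) (w) => ? ? [].
Qed.

Lemma continuous_Im : continuous (@complex.Im R : R[i]^o -> R).
Proof.
move=> z U /nbhs_ballP[e e0 eU]; apply/nbhs_modulus; exists e => // w we.
apply: eU; rewrite -ball_normE /=.
apply: le_lt_trans we; rewrite modulusB; apply: le_trans (normr_Im_le _).
by case: (z) (w) => ? ? [].
Qed.

Lemma real_stem_holomorphic phi z l : quadratic_derivative phi z l ->
  (fun h : R[i]^o => (h : R[i])^-1 *: (real_stem phi (z + h) - real_stem phi z))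
    @ 0^' --> (real_stem (fun=> l) 0).
Proof.
move=> [C [d [C0 d0 H]]].
have -> : (fun h : R[i]^o =>
    (h : R[i])^-1 *: (real_stem phi (z + h) - real_stem phi z)) =
  (fun h : R[i]^o => real_stem id (h^-1 * (phi (z + h) - phi z))).
  apply/funext => h; rewrite /real_stem.
  case: (h^-1) (phi (z + h)) (phi z) => a b [x y] [x' y'].
  by congr pair => /=; rewrite -!scalerBl !scalerA -?scalerBl -?scalerDl.
have cq : (fun h : R[i]^o => (h^-1 * (phi (z + h) - phi z) : R[i]^o))
    @ 0^' --> (l : R[i]^o).
  move=> U /nbhs_modulus[e e0 eU].
  apply/nbhs_modulus; exists (Num.min d (e / (C + 1))).
    by rewrite lt_min d0 divr_gt0//; lra.
  move=> h; rewrite subr0 lt_min => /andP[hd he] h0; apply: eU.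
  have -> : h^-1 * (phi (z + h) - phi z) - l = h^-1 * (phi (z + h) - phi z - l * h).
    by field.
  have hm := modulus_gt0 h0.
  rewrite modulusM modulusV mulrC ltr_pdivrMr//; apply: le_lt_trans (H _ hd) _.
  rewrite expr2 mulrA ltr_pM2r//; move: he; rewrite ltr_pdivlMr; last by lra.
  lra.
have cs : continuous (real_stem id : R[i]^o -> (A * A)%type).
  move=> w.
  have cR := cvgZ (@continuous_Re w) (@cvg_cst _ (aone : A) _ (nbhs w) _).
  have cI := cvgZ (@continuous_Im w) (@cvg_cst _ (aone : A) _ (nbhs w) _).
  have Fw : Filter (nbhs w) by exact: nbhs_filter.
  have c := cvg_pair (cR Fw Fw) (cI Fw Fw).
  exact: c.
exact: (cvg_comp _ _ cq (cs _)).
Qed.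

(** The values at [I] and [- I] determine the sum and the difference of the two
    components; left multiplication by [I] is injective since alternativity gives
    [I (I v) = (I I) v = - v]. *)
Lemma stem_unique (E F : R[i]^o -> complexification A) x y I :
  pseudosphere A I ->
  (forall J, pseudosphere A J ->
     (E (Complex x y)).1 + amul J (E (Complex x y)).2 =
     (F (Complex x y)).1 + amul J (F (Complex x y)).2) ->
  E (Complex x y) = F (Complex x y).
Proof.
move=> SI EF; have E1 := EF _ SI; have E2 := EF _ (pseudosphereN SI).
move: E1 E2; case: (E _) (F _) => e1 e2 [f1 f2] /=; rewrite !amulNl => E1 E2.
have e1f1 : e1 = f1.
  have := congr2 +%R E1 E2; rewrite addrACA subrr addr0 addrACA subrr addr0.
  have half (v : A) : (2^-1 : R) *: (v + v) = v.
    by rewrite scalerDr -scalerDl (_ : _ + _ = 1) ?scale1r//; lra.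
  by move=> /(congr1 (fun v : A => (2^-1 : R) *: v)); rewrite !half.
move: E1; rewrite e1f1 => /addrI /(congr1 (amul I)).
have [_ II] := (pseudosphereP I).1 SI.
by rewrite !amul_altl II !amulNl !amul1x => /oppr_inj ->.
Qed.

(** The difference quotients at [b] are bounded near [b] because they converge. *)
Lemma holomorphic_locally_bounded (E : R[i]^o -> complexification A)
    (H : set R[i]^o) b :
  holomorphic_on H E -> H b ->
  exists B e : R, 0 < e /\ forall z, modulus (z - b) < e ->
    `|(E z).1| + `|(E z).2| <= B.
Proof.
move=> hE Hb; have /cvg_ex[/= [L1 L2] cL] := hE b Hb.
set q := (X in X @ _) in cL.
have c1 : (fun h : R[i]^o => (q h).1) @ 0^' --> L1.
  exact: (cvg_comp _ _ (cL : q @ 0^' --> ((L1, L2) : (A * A)%type))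
    (@cvg_fst _ _ _ _ _)).
have c2 : (fun h : R[i]^o => (q h).2) @ 0^' --> L2.
  exact: (cvg_comp _ _ (cL : q @ 0^' --> ((L1, L2) : (A * A)%type))
    (@cvg_snd _ _ _ _ _)).
have n1 : \forall h \near (0 : R[i]^o)^', `|L1 - (q h).1| < 1.
  by move/cvgrPdist_lt : c1; apply.
have n2 : \forall h \near (0 : R[i]^o)^', `|L2 - (q h).2| < 1.
  by move/cvgrPdist_lt : c2; apply.
have nb : nbhs (0 : R[i]^o) (fun h : R[i]^o => h != 0 ->
  `|L1 - (q h).1| < 1 /\ `|L2 - (q h).2| < 1) :=
    @filterI _ _ (dnbhs_filter (0 : R[i]^o)) _ _ n1 n2.
have [e e0 eP] := (nbhs_modulus _ _).1 nb.
pose Q := `|L1| + `|L2| + 2.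
exists (`|(E b).1| + `|(E b).2| + 2 * Q), (Num.min 1 e); split.
  by rewrite lt_min ltr01.
move=> z; rewrite lt_min => /andP[z1 ze].
have Q0 : 0 <= Q by rewrite /Q; have := normr_ge0 L1; have := normr_ge0 L2; lra.
have [->|zb] := eqVneq z b; first by rewrite lerDl mulr_ge0.
have k0 : z - b != 0 by rewrite subr_eq0.
have [] := eP (z - b) _ k0; rewrite ?subr0// => {}n1 {}n2.
have Ez : E z = E b + (z - b) *: q (z - b).
  by rewrite /q scalerA mulfV// scale1r addrC (addrC b) subrK subrK.
have q1 : `|(q (z - b)).1| <= `|L1| + 1.
  have := ler_normB L1 (L1 - (q (z - b)).1); rewrite subKr; lra.
have q2 : `|(q (z - b)).2| <= `|L2| + 1.
  have := ler_normB L2 (L2 - (q (z - b)).2); rewrite subKr; lra.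
have r1 : `|Re (z - b)| <= 1 := le_trans (normr_Re_le _) (ltW z1).
have i1 : `|Im (z - b)| <= 1 := le_trans (normr_Im_le _) (ltW z1).
rewrite Ez; move: q1 q2 r1 i1; move: (q (z - b)) (E b) => [q1 q2] [e1 e2].
case: (z - b) => x y /= hq1 hq2 hx hy.
have s (t : R) (v : A) : `|t| <= 1 -> `|t *: v| <= `|v|.
  by move=> t1; rewrite normrZ ler_piMl.
have := ler_normD e1 (x *: q1 - y *: q2); have := ler_normB (x *: q1) (y *: q2).
have := ler_normD e2 (x *: q2 + y *: q1); have := ler_normD (x *: q2) (y *: q1).
have := s x q1 hx; have := s x q2 hx; have := s y q1 hy; have := s y q2 hy.
by rewrite /Q; lra.
Qed.

End InducedFunction.

(** * The non-extendable function *)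

Theorem corollary18p2 (R : realType) (A : altStarAlgType R)
    (hS : pseudosphere A !=set0)
    (G : set R[i]^o) (hG : symmetric_domain G) :
  exists f : A -> A,
    [/\ slice_regular G f,
        discrete_in (axial_domain A G) (zeroes G f) &
        forall H : set R[i]^o, symmetric_domain H ->
          axial_domain A G `<` axial_domain A H ->
          axial_domain A H `<=` quadratic_cone A ->
          ~ exists2 g : A -> A, slice_regular H g &
              forall q, axial_domain A G q -> g q = f q].
Proof.
have [I0 SI0] := hS; have [G0 oG GJ _] := hG.
have [h [dh hJ blow_up]] := exists_barrier G0 oG GJ.
pose phi := cexp \o h.
have phiJ z : G z -> phi (conjc z) = conjc (phi z).
  by move=> Gz; rewrite /phi /= hJ// cexpJ.
have [f fE] := @induced_function_exists R A phi G phiJ.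
have fF x y I : G (Complex x y) -> pseudosphere A I -> f (slice_point x y I) =
    (@real_stem R A phi (Complex x y)).1 + amul I (@real_stem R A phi (Complex x y)).2.
  by move=> Gz SI; rewrite fE// /real_stem /= amulZr amulx1.
(* A zero at [x + y I] would be a zero of the exponential [phi] at [x + y i]. *)
have no_zero : zeroes G f = set0.
  rewrite -subset0 => q [[x [y [I [Gz SI ->]]]]]; rewrite fE// => f0.
  have z0 : slice_point (complex.Re (phi (Complex x y)))
      (complex.Im (phi (Complex x y))) I = slice_point 0 0 I.
    by rewrite f0 /slice_point /areal !scale0r addr0.
  have [r0 i0] := slice_point_inj SI SI z0.
  have := expR_gt0 (complex.Re (h (Complex x y))); rewrite -modulus_cexp -/(phi _).
  have -> : cexp (h (Complex x y)) = 0; last by rewrite modulus0 ltxx.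
  have i0' : complex.Im (phi (Complex x y)) = 0.
    by case: i0 => -[-> _] //; rewrite oppr0.
  by apply/eqP; rewrite eq_complex -[cexp _]/(phi (Complex x y)) r0 i0' !eqxx.
exists f; split.
- exists (@real_stem R A phi) => //; split.
    move=> z /dh[l /quadratic_derivative_cexp dphi].
    by apply/cvg_ex; eexists; exact: real_stem_holomorphic dphi.
  by move=> z /phiJ E; rewrite /real_stem E; case: (phi z) => a b /=; rewrite scaleNr.
- rewrite no_zero; split=> //; rewrite -subset0 => q [_ /(_ setT filterT)].
  by case=> y [_ []].
move=> H hH [GH HG] _ [g [E [hE EJ] gE] gf].
have [_ _ HJ _] := hH.
have subH x y : G (Complex x y) -> H (Complex x y).
  move=> Gz; have [x' [y' [J [Hz SJ]]]] : axial_domain A H (slice_point x y I0).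
    by apply: GH; exists x, y, I0.
  move=> /(slice_point_inj SI0 SJ)[-> [[-> _]//|[-> _]]].
  by move/HJ : Hz.
have GsubH : G `<=` H by case=> x y; exact: subH.
have HnG : ~ (H `<=` G).
  move=> HsG; apply: HG => q [x [y [I [Hz SI ->]]]].
  by exists x, y, I; split=> //; exact: HsG.
have EF z : G z -> E z = @real_stem R A phi z.
  case: z => x y Gz; apply: (stem_unique SI0) => J SJ.
  rewrite -gE//; last exact: subH.
  by rewrite gf ?fF//; exists x, y, J.
have [b [Hb Gb clb]] := exists_frontier_point G0 oG GJ hH GsubH HnG.
have [B [e [e0 Be]]] := holomorphic_locally_bounded hE Hb.
have [z [Gz zb Mz]] := blow_up b Gb clb (B / `|aone : A|) e e0.
have a0 : 0 < `|aone : A| by rewrite normr_gt0 aone_neq0.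
(* [modulus (phi z) = expR (Re (h z)) > Re (h z)] exceeds the bound near [b]. *)
have := Be z zb; rewrite EF// /real_stem /= !normrZ -mulrDl leNgt => /negP; apply.
rewrite -ltr_pdivrMr//; apply: lt_le_trans Mz _.
have := modulus_le_ReIm (phi z); rewrite /phi modulus_cexp /= !normrM.
by have := expR_ge1Dx (complex.Re (h z)); lra.
Qed.
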